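(* Let $\Omega$ be a locally compact Hausdorff space with countable base, $0<q<1$, and let $G\colon\Omega\times\Omega\to[0,+\infty]$ be a lower semicontinuous quasi-symmetric kernel with quasi-symmetry constant $a$. Let $\sigma\in\mathcal{M}^+(\Omega)$, and suppose there is a positive supersolution $u\in L^q(\Omega,\sigma)$, i.e. $u\ge\mathbf{G}(u^q\sigma)$ and $u>0$ $d\sigma$-a.e. in $\Omega$. Let $q_0=\frac{\sqrt5-1}{2}$. (a) If $0<q\le q_0$, then $$\int_\Omega(\mathbf{G}\sigma)^{\frac{q}{1-q}}\,d\sigma\le c\int_\Omega u^q\,d\sigma<\infty,\qquad c=a^{\frac{q^2}{1-q}}.$$ (b) If $q_0<q<1$ and $\sigma$ is a finite measure, then for every $0<s\le1+q$, $$\int_\Omega(\mathbf{G}\sigma)^s\,d\sigma\le c\left[\int_\Omega u^q\,d\sigma\right]^{\frac{s(1-q)}{q}}\bigl[\sigma(\Omega)\bigr]^{1-\frac{s(1-q)}{q}}<\infty,\qquad c=a^{\frac{s}{1+q}}.$$ For symmetric kernels $G$, both estimates hold with $c=1$.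
   Context: $\mathcal{M}^+(\Omega)$ is the class of nonnegative, locally finite Borel (Radon) measures on $\Omega$. $\mathbf{G}\nu(x)=\int_\Omega G(x,y)\,d\nu(y)$ and $\mathbf{G}(u^q\sigma)(x)=\int_\Omega G(x,y)u(y)^q\,d\sigma(y)$. $G$ is quasi-symmetric with constant $a>0$ if $a^{-1}G(y,x)\le G(x,y)\le a\,G(y,x)$ for all $x,y\in\Omega$. *)

(* Defs.v *)
From HB Require Import structures.
From mathcomp Require Import all_boot all_order all_algebra.
From mathcomp Require Import all_classical all_reals all_analysis.
From mathcomp Require Import measurable_realfun.

Set Implicit Arguments.
Unset Strict Implicit.
Unset Printing Implicit Defensive.

Import Order.TTheory GRing.Theory Num.Theory.
Import numFieldNormedType.Exports.

Local Open Scope classical_set_scope.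
Local Open Scope ring_scope.
Local Open Scope ereal_scope.

(* [T] with its Borel sigma-algebra. The measurable structure exists only for
   pointed [T] (hence [ptopologicalType] below): this excludes only the empty
   space. *)
Notation borel T := (g_sigma_algebraType (@open T)).

Section Kernel.
Context {R : realType} {T : ptopologicalType}.
Implicit Types (G : T * T -> \bar R) (u : T -> \bar R) (q a : R).
Implicit Types (nu sigma : {measure set (borel T) -> \bar R}).

Definition locally_finite nu : Prop :=
  forall x : T, exists U : set T, [/\ open U, U x & nu U < +oo].

Definition quasi_symmetric G a : Prop :=
  forall x y : T,
    a^-1%:E * G (y, x) <= G (x, y) /\ G (x, y) <= a%:E * G (y, x).

Definition symmetric_kernel G : Prop :=
  forall x y : T, G (x, y) = G (y, x).

Definition potential G nu (x : T) : \bar R :=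
  \int[nu]_(y in [set: borel T]) G (x, y).

(* [G (u^q sigma)] *)
Definition density_potential G sigma q u (x : T) : \bar R :=
  \int[sigma]_(y in [set: borel T]) (G (x, y) * u y `^ q).

(* For [q < 1], ['N_q] is only a quasi-norm, but its finiteness still means
   that [`|u|^q] is integrable. *)
Definition in_Lspace sigma q u : Prop :=
  measurable_fun [set: borel T] u /\
  'N[sigma]_(q%:E)[u] < +oo.

Definition positive_supersolution G sigma q u : Prop :=
  {ae sigma, forall x : borel T, density_potential G sigma q u x <= u x} /\
  {ae sigma, forall x : borel T, 0 < u x}.

End Kernel.

(* Main.v *)
(**
  Let [w] be an everywhere positive and finite version of [u], and
  [H = G(w^(-b) sigma)].  For [0 < t < 1] and [b = q(1-t)/t], Hoelder's
  inequality applied to [G = (G w^q)^(1-t) (G w^(-b))^t], together with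
  [G(w^q sigma) <= w], gives [(G sigma)^(q/(1-t)) <= w^q H^r] with
  [r = qt/(1-t)].  By Tonelli and quasi-symmetry,
  [\int w^q H <= a \int w^(1-b)], so if [r <= 1], Hoelder for the measure
  [w^q sigma] yields
  [\int (G sigma)^(q/(1-t)) <= (\int w^q)^(1-r) (a \int w^(1-b))^r].
  Part (a) is [t = q], where [1-b = q] and [r <= 1] means [q^2 + q <= 1].
  Part (b) with [s = 1+q] is [t = 1/(1+q)], where [r = 1] and [b = q^2]; then
  [1 - q^2 < q], and Jensen's inequality bounds [\int w^(1-q^2)] by [\int w^q]
  and reduces the smaller exponents [s] to [1+q].
*)
Require Import Defs.
From HB Require Import structures.
From mathcomp Require Import all_boot all_order all_algebra.
From mathcomp Require Import all_classical all_reals all_analysis.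
From mathcomp Require Import measurable_realfun.
From mathcomp Require Import ring lra.

Set Implicit Arguments.
Unset Strict Implicit.
Unset Printing Implicit Defensive.

Import Order.TTheory GRing.Theory Num.Theory.
Import numFieldNormedType.Exports.

Local Open Scope classical_set_scope.
Local Open Scope ring_scope.
Local Open Scope ereal_scope.

(** * Hoelder's inequality for functions with values in $[0,+\infty]$ *)

Section Hoelder.
Context d (X : measurableType d) (R : realType).
Variable mu : {measure set X -> \bar R}.
Implicit Types (f g : X -> \bar R) (t s : R).

(** For finite values this is Young's inequality with the conjugate exponents $1/(1-t)$ and $1/t$.
    If a value is infinite, so is the right-hand side, because both coefficients are positive. *)
Lemma young_poweR (x y : \bar R) t : 0 <= x -> 0 <= y -> (0 < t < 1)%R ->
  x `^ (1 - t) * y `^ t <= (1 - t)%:E * x + t%:E * y.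
Proof.
move=> + + /andP[t0 t1]; have t1' : (0 < 1 - t)%R by rewrite subr_gt0.
case: x => [x| |]//; case: y => [y| |]// x0 y0.
- move: x0 y0; rewrite !(@lee_fin R 0%R) => x0 y0.
  rewrite !poweR_EFin -!EFinM -EFinD lee_fin.
  have := @conjugate_powR R (x `^ (1 - t))%R (y `^ t)%R (1 - t)^-1%R t^-1%R
    (powR_ge0 _ _) (powR_ge0 _ _).
  rewrite !invr_gt0 t1' t0 !invrK subrK -!powRrM !divff ?gt_eqF// !powRr1//.
  by rewrite ![(_ * x)%R]mulrC ![(_ * y)%R]mulrC; apply.
- by rewrite gt0_muley ?lte_fin// addey ?leey.
- by rewrite gt0_muley ?lte_fin// addye ?leey.
- by rewrite !gt0_muley ?lte_fin// addye ?leey.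
Qed.

Lemma measurable_fun_poweR f s : measurable_fun setT f ->
  measurable_fun setT (fun x => f x `^ s).
Proof. exact: (measurableT_comp (measurable_poweR s)). Qed.

(** Here $f=0$ almost everywhere, hence so is $f^s g^t$, even where $g^t=+\infty$, by the convention
    $0\cdot\infty=0$. This is the degenerate case of Hoelder's inequality. *)
Lemma integral_poweRM_eq0 f g s t : measurable_fun setT f ->
  measurable_fun setT g -> (forall x, 0 <= f x) -> s != 0%R ->
  \int[mu]_x f x = 0 -> \int[mu]_x (f x `^ s * g x `^ t) = 0.
Proof.
move=> mf mg f0 s0 intf0.
have : \int[mu]_x `|f x| = 0.
  by under eq_integral do rewrite gee0_abs//.
move/(ae_eq_integral_abs mu measurableT mf) => f00.
rewrite (@ge0_ae_eq_integral _ _ _ mu setT _ (cst 0)) ?integral0//.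
- by apply: emeasurable_funM; exact: measurable_fun_poweR.
- by move=> x _; rewrite mule_ge0 ?poweR_ge0.
- by apply: filterS f00 => x /(_ I) /= ->; rewrite poweR0r ?mul0e.
Qed.

(** Integrate Young's inequality after dividing $f$ and $g$ by their integrals. No integrability is
    assumed: a zero integral makes the left side vanish, and otherwise an infinite one makes the
    right side infinite. The endpoints $t=0,1$ are included since the exponent 1 does occur
    later. *)
Lemma hoelder_poweR f g t : measurable_fun setT f -> measurable_fun setT g ->
  (forall x, 0 <= f x) -> (forall x, 0 <= g x) -> (0 <= t <= 1)%R ->
  \int[mu]_x (f x `^ (1 - t) * g x `^ t) <=
  (\int[mu]_x f x) `^ (1 - t) * (\int[mu]_x g x) `^ t.
Proof.
move=> mf mg f0 g0 /andP[].
have A0 : 0 <= \int[mu]_x f x by exact: integral_ge0.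
have B0 : 0 <= \int[mu]_x g x by exact: integral_ge0.
(* At the endpoints both sides agree, since $x^0=1$ for every $x\in[0,+\infty]$. *)
rewrite le_eqVlt => /predU1P[<- _|t0].
  rewrite subr0 poweRe0 mule1 poweRe1//.
  by under eq_integral do rewrite poweRe1// poweRe0 mule1.
rewrite le_eqVlt => /predU1P[->|t1].
  rewrite subrr poweRe0 mul1e poweRe1//.
  by under eq_integral do rewrite poweRe0 mul1e poweRe1//.
have t1' : (0 < 1 - t)%R by rewrite subr_gt0.
have [A00|An0] := eqVneq (\int[mu]_x f x) 0.
  by rewrite integral_poweRM_eq0 ?mule_ge0 ?poweR_ge0 ?gt_eqF.
have [B00|Bn0] := eqVneq (\int[mu]_x g x) 0.
  under eq_integral do rewrite muleC.
  by rewrite integral_poweRM_eq0 ?mule_ge0 ?poweR_ge0 ?gt_eqF.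
have {}A0 : 0 < \int[mu]_x f x by rewrite lt0e An0.
have {}B0 : 0 < \int[mu]_x g x by rewrite lt0e Bn0.
have [->|Afin] := eqVneq (\int[mu]_x f x) +oo.
  by rewrite poweRyr ?gt_eqF// gt0_mulye ?leey ?poweR_gt0.
have [->|Bfin] := eqVneq (\int[mu]_x g x) +oo.
  by rewrite poweRyr ?gt_eqF// gt0_muley ?leey ?poweR_gt0.
have : \int[mu]_x f x \is a fin_num by rewrite gt0_fin_numE// ltey.
have : \int[mu]_x g x \is a fin_num by rewrite gt0_fin_numE// ltey.
move=> /fineK + /fineK.
set A := \int[mu]_x f x in A0 *; set B := \int[mu]_x g x in B0 *.
set b := fine B; set a := fine A => bE aE.
have a0 : (0 < a)%R by rewrite -lte_fin aE.
have b0 : (0 < b)%R by rewrite -lte_fin bE.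
(* Used with $c=A$ and $c=B$, this pulls $A^{1-t}B^t$ out of the integral and leaves functions of
   integral 1. *)
have scale (c : R) (z : \bar R) : (0 < c)%R -> 0 <= z -> z = c%:E * (c^-1%:E * z).
  by move=> c0 z0; rewrite muleA -EFinM divff ?gt_eqF// mul1e.
have scale_ge0 (c : R) (z : \bar R) : (0 < c)%R -> 0 <= z -> 0 <= c^-1%:E * z.
  by move=> c0 z0; rewrite mule_ge0// lee_fin invr_ge0 ltW.
under eq_integral => x _.
  rewrite (scale a (f x))// (scale b (g x))//.
  rewrite (@poweRM _ a%:E) ?(@poweRM _ b%:E) ?scale_ge0 ?lee_fin ?(ltW a0) ?(ltW b0)//.
  rewrite muleACA.
  over.
have mZ (c : R) (h : X -> \bar R) : measurable_fun [set: X] h ->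
    measurable_fun [set: X] (fun x => c%:E * h x).
  by move=> mh; exact: emeasurable_funM.
rewrite ge0_integralZl//; last 3 first.
- by apply: emeasurable_funM; apply: measurable_fun_poweR; exact/mZ.
- by move=> x _; rewrite mule_ge0 ?poweR_ge0.
- by rewrite mule_ge0 ?poweR_ge0.
rewrite aE bE -[leRHS]mule1 lee_pmul2l; last 2 first.
- by rewrite -aE -bE !poweR_EFin.
- by rewrite mule_gt0 ?poweR_gt0.
(* Young's inequality holds pointwise, and the integral of its right-hand side is $(1-t)+t=1$. *)
apply: (@le_trans _ _ (\int[mu]_x ((1 - t)%:E * (a^-1%:E * f x) +
                             t%:E * (b^-1%:E * g x)))).
  apply: ge0_le_integral => //.
  - by move=> x _; rewrite mule_ge0 ?poweR_ge0.
  - by apply: emeasurable_funM; apply: measurable_fun_poweR; exact/mZ.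
  - by apply: emeasurable_funD; apply/mZ/mZ.
  - by move=> x _; apply: young_poweR; rewrite ?scale_ge0// t0.
rewrite ge0_integralD//; last 4 first.
- by move=> x _; rewrite mule_ge0 ?scale_ge0// lee_fin ltW.
- by apply/mZ/mZ.
- by move=> x _; rewrite mule_ge0 ?scale_ge0// lee_fin ltW.
- by apply/mZ/mZ.
rewrite !ge0_integralZl ?lee_fin ?invr_ge0 ?(ltW a0) ?(ltW b0) ?(ltW t0) ?(ltW t1')//.
all: rewrite ?scale_ge0//.
- rewrite -/A -/B -aE -bE -!EFinM -!EFinD lee_fin !mulVf ?gt_eqF//.
  by rewrite !mulr1 subrK.
- by exact/mZ.
- by move=> x _; rewrite scale_ge0.
- by exact/mZ.
- by move=> x _; rewrite scale_ge0.
Qed.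

(** Jensen's inequality without normalizing the measure: Hoelder with the constant function 1. *)
Lemma integral_poweR_le f t : measurable_fun setT f -> (forall x, 0 <= f x) ->
  (0 <= t <= 1)%R ->
  \int[mu]_x (f x `^ t) <= mu setT `^ (1 - t) * (\int[mu]_x f x) `^ t.
Proof.
move=> mf f0 t01.
have := hoelder_poweR (@measurable_cst _ _ _ _ setT 1) mf (fun=> lee01) f0 t01.
rewrite integral_cst// mul1e.
by under eq_integral do rewrite poweR1r mul1e.
Qed.

End Hoelder.

Lemma le_poweR (R : realType) (x y : \bar R) (r : R) : (0 <= r)%R ->
  0 <= x -> x <= y -> x `^ r <= y `^ r.
Proof.
move=> r0 x0 xy; apply: gt0_ler_poweR => //; rewrite in_itv/= leey andbT//.
exact: le_trans xy.
Qed.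

(** * The interpolated bound for a general parameter $t$ *)

Section KernelEstimate.
Context d (X : measurableType d) (R : realType).
Variable m : {sigma_finite_measure set X -> \bar R}.
Variables (K : X * X -> \bar R) (a q : R) (w : X -> R).
Hypothesis mK : measurable_fun setT K.
Hypothesis K0 : forall z, 0 <= K z.
Hypothesis a0 : (0 < a)%R.
Hypothesis Ka : forall x y, K (x, y) <= a%:E * K (y, x).
Hypothesis q0 : (0 < q)%R.
Hypothesis mw : measurable_fun setT w.
Hypothesis w0 : forall x, (0 < w x)%R.
Hypothesis wK :
  {ae m, forall x, \int[m]_y (K (x, y) * (w y `^ q)%:E) <= (w x)%:E}.

Let mwX s : measurable_fun setT (fun x => (w x `^ s)%:E).
Proof. exact/measurable_EFinP/(measurableT_comp (@measurable_powR R s) mw). Qed.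

Let wX_ge0 s x : 0 <= (w x `^ s)%:E.
Proof. by rewrite lee_fin powR_ge0. Qed.

Let mKr x : measurable_fun setT (fun y => K (x, y)).
Proof. exact: (measurableT_comp mK (pair1_measurable x)). Qed.

Let mKw s : measurable_fun setT (fun z => K z * (w z.2 `^ s)%:E).
Proof. by apply: emeasurable_funM => //; exact: measurableT_comp (mwX s) _. Qed.

Let mKwr x s : measurable_fun setT (fun y => K (x, y) * (w y `^ s)%:E).
Proof. exact: emeasurable_funM. Qed.

Let mpot s : measurable_fun setT (fun x => \int[m]_y (K (x, y) * (w y `^ s)%:E)).
Proof.
apply: (measurable_fun_fubini_tonelli_F (fun z => K z * (w z.2 `^ s)%:E)) => //.
by move=> z; rewrite mule_ge0.
Qed.

Let pot_ge0 s x : 0 <= \int[m]_y (K (x, y) * (w y `^ s)%:E).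
Proof. by apply: integral_ge0 => y _; rewrite mule_ge0. Qed.

Lemma integral_weighted_potential_le b :
  \int[m]_x ((w x `^ q)%:E * \int[m]_y (K (x, y) * (w y `^ (- b))%:E)) <=
  a%:E * \int[m]_x (w x `^ (1 - b))%:E.
Proof.
pose F z := (w z.1 `^ q)%:E * (K z * (w z.2 `^ (- b))%:E).
have F0 z : 0 <= F z by rewrite !mule_ge0.
have mF : measurable_fun setT F.
  by apply: emeasurable_funM => //; exact: measurableT_comp (mwX q) _.
rewrite (_ : \int[m]_x _ = \int[m]_x \int[m]_y F (x, y)); last first.
  by apply: eq_integral => x _; rewrite -ge0_integralZl// => y _; rewrite mule_ge0.
(* After the exchange of integrals, $y$ is the outer variable. Flipping the kernel costs the factor
   $a$ and turns the inner integral into $w(y)^{-b}$ times the potential of $w^q$ at $y$, which is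
   at most $w(y)$ for almost every $y$. *)
rewrite fubini_tonelli// -ge0_integralZl_EFin ?(ltW a0)//.
apply: ae_ge0_le_integral => //.
- by move=> y _; exact: integral_ge0.
- exact: (measurable_fun_fubini_tonelli_G F).
- by move=> y _; rewrite mule_ge0// lee_fin ltW.
- exact: emeasurable_funM.
apply: filterS wK => y wy _.
apply: (@le_trans _ _ (\int[m]_x ((a * w y `^ (- b))%:E *
                                  (K (y, x) * (w x `^ q)%:E)))).
  apply: ge0_le_integral => //.
  - exact: measurableT_comp mF (pair2_measurable y).
  - exact: emeasurable_funM.
  - move=> x _; rewrite EFinM [leRHS]muleACA.
    rewrite (_ : F (x, y) = K (x, y) * ((w y `^ (- b))%:E * (w x `^ q)%:E)).
      by rewrite lee_wpmul2r// mule_ge0.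
    by rewrite /F/= muleCA (muleC (w x `^ q)%:E).
rewrite ge0_integralZl//; last 2 first.
- by move=> x _; rewrite mule_ge0.
- by rewrite lee_fin mulr_ge0 ?powR_ge0// ltW.
rewrite powRD; last by rewrite (gt_eqF (w0 y)) implybT.
rewrite powRr1 ?(ltW (w0 y))// !EFinM -!muleA lee_pmul2l// ?lte_fin//.
by rewrite muleC lee_pmul2r// lte_fin powR_gt0.
Qed.

Lemma integral_poweR_potential_le t : (0 < t < 1)%R -> (q * t <= 1 - t)%R ->
  \int[m]_x ((\int[m]_y K (x, y)) `^ (q / (1 - t))) <=
  (\int[m]_x (w x `^ q)%:E) `^ (1 - q * t / (1 - t)) *
  (a%:E * \int[m]_x (w x `^ (1 - q * (1 - t) / t))%:E) `^ (q * t / (1 - t)).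
Proof.
move=> /andP[t0 t1] qt.
have t1' : (0 < 1 - t)%R by rewrite subr_gt0.
set s := (q / (1 - t))%R; set r := (q * t / (1 - t))%R; set b := (q * (1 - t) / t)%R.
have r0 : (0 <= r)%R by rewrite divr_ge0 ?mulr_ge0 ?ltW.
have r1 : (r <= 1)%R by rewrite ler_pdivrMr// mul1r.
(* The exponent $s$ is chosen so that the bound $w^{(1-t)s}$ is exactly $w^q$; $b$ is chosen so that
   the weights $w^{q(1-t)}$ and $w^{-bt}$ cancel. *)
have ts : ((1 - t) * s = q)%R by rewrite /s mulrC divfK ?gt_eqF.
have tsr : (t * s = r)%R by rewrite /s /r mulrA (mulrC t).
have bt : (q * (1 - t) = b * t)%R by rewrite /b divfK ?gt_eqF.
have s0 : (0 <= s)%R by rewrite divr_ge0 ?ltW.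
pose H x := \int[m]_y (K (x, y) * (w y `^ (- b))%:E).
have H0 x : 0 <= H x by exact: pot_ge0.
have mwH : measurable_fun setT (fun x => (w x `^ q)%:E * H x).
  exact: emeasurable_funM (mwX q) (mpot (- b)).
(* The bound $w^qH^r$ is written as $(w^q)^{1-r}(w^qH)^r$, so that Hoelder for the weighted measure
   becomes Hoelder for [m]. *)
have interp x : \int[m]_y (K (x, y) * (w y `^ q)%:E) <= (w x)%:E ->
    (\int[m]_y K (x, y)) `^ s <=
    (w x `^ q)%:E `^ (1 - r) * ((w x `^ q)%:E * H x) `^ r.
  move=> wx.
  have -> : \int[m]_y K (x, y) = \int[m]_y
      ((K (x, y) * (w y `^ q)%:E) `^ (1 - t) *
       (K (x, y) * (w y `^ (- b))%:E) `^ t).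
    apply: eq_integral => y _.
    rewrite !poweRM// muleACA !poweR_EFin -!powRrM -EFinM -powRD; last first.
      by rewrite (gt_eqF (w0 y)) implybT.
    rewrite mulNr bt subrr powRr0 mule1 -poweRD ?subrK ?poweRe1//.
    by rewrite add_neq0_poweRD_def// subrK oner_neq0.
  have h := @hoelder_poweR _ X R m (fun y => K (x, y) * (w y `^ q)%:E)
    (fun y => K (x, y) * (w y `^ (- b))%:E) t (mKwr x _) (mKwr x _)
    (fun y => mule_ge0 (K0 _) (wX_ge0 _ _)) (fun y => mule_ge0 (K0 _) (wX_ge0 _ _)).
  have {}h := le_poweR s0 (integral_ge0 _ _) (h _).
  apply: (le_trans (h _ _)).
  - by move=> y _; rewrite mule_ge0// poweR_ge0.
  - by rewrite !ltW.
  rewrite poweRM ?poweR_ge0// -!poweRrM ts tsr poweRM//.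
  rewrite [leRHS]muleA -poweRD ?subrK; last first.
    by rewrite add_neq0_poweRD_def// subrK oner_neq0.
  rewrite poweRe1// lee_wpmul2r ?poweR_ge0// -poweR_EFin le_poweR//.
  exact: ltW.
apply: (@le_trans _ _ (\int[m]_x
    ((w x `^ q)%:E `^ (1 - r) * ((w x `^ q)%:E * H x) `^ r))).
  apply: ae_ge0_le_integral => //.
  - by move=> x _; rewrite poweR_ge0.
  - by apply: measurable_fun_poweR; exact: (measurable_fun_fubini_tonelli_F K).
  - by move=> x _; rewrite mule_ge0 ?poweR_ge0.
  - by apply: emeasurable_funM; apply: measurable_fun_poweR.
  - by apply: filterS wK => x wx _; exact: interp.
apply: (le_trans (hoelder_poweR _ _ _ _ _ _)) => //.
- by move=> x; rewrite mule_ge0.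
- by rewrite r0.
rewrite lee_wpmul2l ?poweR_ge0// le_poweR//.
  by apply: integral_ge0 => x _; rewrite mule_ge0.
exact: integral_weighted_potential_le.
Qed.

End KernelEstimate.

(** Completing the square: both inequalities say $(2q+1)^2\le5$. *)
Lemma le_golden_ratio_conj (R : realType) (q : R) : (0 < q)%R ->
  (q <= (Num.sqrt 5 - 1) / 2)%R = (q ^+ 2 + q <= 1)%R.
Proof.
move=> q0; rewrite ler_pdivlMr// lerBrDr.
have h : (0 <= q * 2 + 1)%R by lra.
rewrite -[in LHS](ger0_norm h) -sqrtr_sqr ler_sqrt//.
by apply/idP/idP; lra.
Qed.

(** * The two choices of $t$, for a positive finite weight *)

Section PotentialEstimates.
Context d (X : measurableType d) (R : realType).
Variable m : {sigma_finite_measure set X -> \bar R}.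
Variables (K : X * X -> \bar R) (a q : R) (w : X -> R).
Hypothesis mK : measurable_fun setT K.
Hypothesis K0 : forall z, 0 <= K z.
Hypothesis a0 : (0 < a)%R.
Hypothesis Ka : forall x y, K (x, y) <= a%:E * K (y, x).
Hypothesis q0 : (0 < q)%R.
Hypothesis q1 : (q < 1)%R.
Hypothesis mw : measurable_fun setT w.
Hypothesis w0 : forall x, (0 < w x)%R.
Hypothesis wK :
  {ae m, forall x, \int[m]_y (K (x, y) * (w y `^ q)%:E) <= (w x)%:E}.

Let I := \int[m]_x (w x `^ q)%:E.

Let I0 : 0 <= I.
Proof. by apply: integral_ge0 => x _; rewrite lee_fin powR_ge0. Qed.

Lemma potential_estimate_small : (q ^+ 2 + q <= 1)%R ->
  \int[m]_x ((\int[m]_y K (x, y)) `^ (q / (1 - q))) <=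
  (a `^ (q ^+ 2 / (1 - q)))%:E * I.
Proof.
move=> qq; have q1' : (0 < 1 - q)%R by rewrite subr_gt0.
have := integral_poweR_potential_le mK K0 a0 Ka q0 mw w0 wK (t := q).
rewrite q0 q1 => /(_ isT).
have -> : (q * q <= 1 - q)%R by lra.
move=> /(_ isT) /le_trans; apply.
(* Both integrals on the right are now $I$, and $I^{1-r}(aI)^r=a^rI$ with $r=q^2/(1-q)$. *)
rewrite (_ : 1 - q * (1 - q) / q = q)%R; last by field; rewrite gt_eqF.
rewrite -/I -expr2 poweRM ?lee_fin ?(ltW a0)// muleCA -poweRD ?subrK; last first.
  by rewrite add_neq0_poweRD_def// subrK oner_neq0.
by rewrite poweRe1.
Qed.

Lemma potential_estimate_large (s : R) : m setT < +oo -> (1 < q ^+ 2 + q)%R ->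
  (0 < s <= 1 + q)%R ->
  \int[m]_x ((\int[m]_y K (x, y)) `^ s) <=
  (a `^ (s / (1 + q)))%:E *
  (I `^ (s * (1 - q) / q) * m setT `^ (1 - s * (1 - q) / q)).
Proof.
move=> moo qq /andP[s0 s1]; have q1' : (0 < 1 + q)%R by lra.
have mP : measurable_fun setT (fun x => \int[m]_y K (x, y)).
  exact: (measurable_fun_fubini_tonelli_F K).
(* The endpoint $s=1+q$. The integrand $w^{1-q^2}$ is recorded as a power of $w^q$, ready for
   Jensen's inequality. *)
have main : \int[m]_x ((\int[m]_y K (x, y)) `^ (1 + q)) <=
    a%:E * \int[m]_x ((w x `^ q)%:E `^ ((1 - q ^+ 2) / q)).
  have := integral_poweR_potential_le mK K0 a0 Ka q0 mw w0 wK (t := ((1 + q)^-1)%R).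
  have t1 : (0 < 1 - (1 + q)^-1)%R by rewrite subr_gt0 invf_lt1// ltrDl.
  rewrite invr_gt0 q1' -subr_gt0 t1 => /(_ isT).
  have tE : (1 - (1 + q)^-1 = q / (1 + q))%R by field; rewrite gt_eqF.
  rewrite tE lexx (_ : q / (q / (1 + q)) = 1 + q)%R; last first.
    by field; rewrite !gt_eqF.
  move=> /(_ isT) /le_trans; apply.
  rewrite (_ : q / (1 + q) / (q / (1 + q)) = 1)%R; last first.
    by rewrite divff// gt_eqF// divr_gt0.
  rewrite subrr poweRe0 mul1e poweRe1; last first.
    rewrite mule_ge0 ?lee_fin ?(ltW a0)//.
    by apply: integral_ge0 => x _; rewrite lee_fin powR_ge0.
  rewrite (_ : q * (q / (1 + q)) / (1 + q)^-1 = q ^+ 2)%R; last first.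
    by field; rewrite gt_eqF.
  rewrite le_eqVlt; apply/orP; left; apply/eqP; congr (_ * _).
  apply: eq_integral => x _; rewrite poweR_EFin -powRrM; congr (_ `^ _)%:E.
  by rewrite mulrC divfK// gt_eqF.
set p := (s / (1 + q))%R; set v := ((1 - q ^+ 2) / q)%R in main.
have p0 : (0 < p)%R by rewrite divr_gt0.
have p1 : (p <= 1)%R by rewrite ler_pdivrMr// mul1r.
have v0 : (0 < v)%R by rewrite divr_gt0// subr_gt0 expr_lt1 ?(ltW q0).
(* This is where $q$ must exceed the golden ratio bound: $1-q^2<q$. *)
have v1 : (v < 1)%R by rewrite ltr_pdivrMr// mul1r; lra.
have vp : (v * p = s * (1 - q) / q)%R.
  by rewrite /v /p; field; rewrite !gt_eqF.
rewrite -vp.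
(* Jensen with exponent $p$, since the $s$-th power is the $p$-th power of the $(1+q)$-th one. *)
have := integral_poweR_le m (t := p) (measurable_fun_poweR (1 + q) mP)
  (fun=> poweR_ge0 _ _).
rewrite (ltW p0) p1 => /(_ isT).
under [X in X <= _ -> _]eq_integral.
  move=> x _; rewrite -poweRrM mulrC divfK ?gt_eqF//; over.
move=> /le_trans; apply.
have {}main : \int[m]_x ((\int[m]_y K (x, y)) `^ (1 + q)) <=
    a%:E * (m setT `^ (1 - v) * I `^ v).
  apply: (le_trans main); rewrite lee_wpmul2l ?lee_fin ?(ltW a0)//.
  apply: integral_poweR_le; last by rewrite !ltW.
  - exact/measurable_EFinP/(measurableT_comp (@measurable_powR R q) mw).
  - by move=> x; rewrite lee_fin powR_ge0.
apply: (@le_trans _ _ (m setT `^ (1 - p) *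
    (a%:E * (m setT `^ (1 - v) * I `^ v)) `^ p)).
  rewrite lee_wpmul2l ?poweR_ge0// le_poweR ?(ltW p0)//.
  by apply: integral_ge0 => x _; rewrite poweR_ge0.
rewrite !poweRM ?mule_ge0 ?poweR_ge0 ?lee_fin ?(ltW a0)// -!poweRrM.
rewrite muleCA (_ : 1 - v * p = 1 - p + (1 - v) * p)%R; last by ring.
(* Since the total mass may be 0, adding exponents needs a nonzero sum; here it is positive because
   $v<1$ and $p>0$. *)
rewrite (@poweRD _ _ (1 - p)%R ((1 - v) * p)%R); last first.
  rewrite add_neq0_poweRD_def//; apply/lt0r_neq0/ltr_wpDl; first by rewrite subr_ge0.
  by apply: mulr_gt0 => //; rewrite subr_gt0.
by rewrite -poweR_EFin (muleC (I `^ _)) -[X in _ <= _ * X]muleA.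
Qed.

End PotentialEstimates.

(** * Joint measurability of the kernel and sigma-finiteness, as required by Tonelli *)

Section BorelProduct.
Context (T : ptopologicalType).
Hypothesis scT : @second_countable T.

Lemma second_countable_seq : exists U : nat -> set T,
  (forall n, open (U n)) /\
  (forall x O, open O -> O x -> exists2 n, U n x & U n `<=` O).
Proof.
have [B /countable_injP[f finj] [Bo Bb]] := scT.
(* The sequence inverts the injection [f] of the base into the naturals; an index outside its range
   gets the default [set0], which is open. *)
exists (fun n => xget set0 [set V | B V /\ f V = n]); split=> [n|x O oO Ox].
  by case: xgetP => [V _ [/Bo]|_]; [|exact: open0].
have [V [BV Vx] VO] := Bb x O (open_nbhs_nbhs (conj oO Ox)).
exists (f V); case: xgetP => [W _ [BW fW]|/(_ V)[]//].
- by rewrite (finj W V) ?inE.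
- by rewrite (finj W V) ?inE.
Qed.

Lemma open_borel_measurable (O : set T) : open O ->
  measurable (O : set (borel T)).
Proof. exact: sub_sigma_algebra. Qed.

Lemma open_prod_borel_measurable (O : set (T * T)) : open O ->
  measurable (O : set (borel T * borel T)).
Proof.
move=> oO; have [U [Uo Ub]] := second_countable_seq.
pose W i j : set (borel T * borel T) :=
  if `[< U i `*` U j `<=` O >] then U i `*` U j else set0.
rewrite (_ : O = \bigcup_i \bigcup_j W i j).
  apply: bigcupT_measurable => i; apply: bigcupT_measurable => j.
  rewrite /W; case: asboolP => // _.
  by apply: measurableX; exact: open_borel_measurable.
apply/seteqP; split=> [[x y] Oxy|z [i _ [j _]]]; last first.
  by rewrite /W; case: asboolP => [UO /UO|_ []].
have [[A B] /= [Ax By] AB] : filter_prod (nbhs x) (nbhs y) O := open_nbhs_nbhs (conj oO Oxy).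
move: Ax By; rewrite !nbhsE => -[A' [oA' A'x] A'A] [B' [oB' B'y] B'B].
have [i Uix UiA] := Ub _ _ oA' A'x.
have [j Ujy UjB] := Ub _ _ oB' B'y.
exists i => //; exists j => //; rewrite /W; case: asboolP => // -[].
move=> [s t] [/= Us Ut]; apply: AB; split => /=.
- exact/A'A/UiA.
- exact/B'B/UjB.
Qed.

Lemma lower_semicontinuous_prod_measurable (R : realType) (f : T * T -> \bar R) :
  lower_semicontinuous f ->
  measurable_fun [set: borel T * borel T] (f : borel T * borel T -> \bar R).
Proof.
move=> scf; apply: (measurability _ (ErealGenOInfty.measurableE R)).
move=> /= _ [_ [c ->]] <-; apply: measurableI => //.
apply: open_prod_borel_measurable.
by rewrite preimage_itvoy; move/lower_semicontinuousP : scf; exact.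
Qed.

Lemma locally_finite_sigma_finite (R : realType)
    (mu : {measure set (borel T) -> \bar R}) :
  locally_finite mu -> sigma_finite setT mu.
Proof.
move=> lf; have [U [Uo Ub]] := second_countable_seq.
exists (fun n => if `[< mu (U n) < +oo >] then U n else set0) => [|n].
  apply/seteqP; split=> // x _; have [V [oV Vx Voo]] := lf x.
  have [n Unx UnV] := Ub _ _ oV Vx.
  exists n => //; case: asboolP => // -[].
  apply: le_lt_trans Voo; apply: le_measure => //; rewrite inE.
  - exact: open_borel_measurable.
  - exact: open_borel_measurable.
case: asboolP => [Uoo|_]; split=> //; first exact: open_borel_measurable.
by rewrite measure0 ltry.
Qed.

End BorelProduct.

Lemma sigma_finite_measureP d (X : measurableType d) (R : realType)
    (mu : {measure set X -> \bar R}) : sigma_finite setT mu ->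
  exists m : {sigma_finite_measure set X -> \bar R},
    mu = m :> {measure set X -> \bar R}.
Proof.
move=> sf.
pose sfin := isSFinite.Build _ _ _ _ (sfinite_measure_sigma_finite sf).
pose sigmafin := isSigmaFinite.Build _ _ _ _ sf.
pose m := HB.pack_for {sigma_finite_measure set X -> \bar R}
  (Measure.sort mu) sfin sigmafin.
by exists m; exact: eq_measure.
Qed.

Section Estimates.
Context (R : realType) (T : ptopologicalType).
Hypothesis scT : @second_countable T.
Variables (q a : R) (G : T * T -> \bar R).
Hypothesis q0 : (0 < q)%R.
Hypothesis q1 : (q < 1)%R.
Hypothesis G0 : forall z, 0 <= G z.
Hypothesis lscG : lower_semicontinuous G.
Hypothesis a0 : (0 < a)%R.
Hypothesis qsG : quasi_symmetric G a.
Variable sigma : {measure set (borel T) -> \bar R}.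
Hypothesis lfs : locally_finite sigma.
Variable u : T -> \bar R.
Hypothesis uLq : in_Lspace sigma q u.
Hypothesis uG : positive_supersolution G sigma q u.

Let Iu := \int[sigma]_(x in [set: borel T]) (u x `^ q).

Let w (x : borel T) : R := if (0 < u x) && (u x < +oo) then fine (u x) else 1%R.

Let w0 x : (0 < w x)%R.
Proof. by rewrite /w; case: ifPn => // ux; rewrite fine_gt0. Qed.

Let measurable_u : measurable_fun [set: borel T] u := uLq.1.

Let mw : measurable_fun [set: borel T] w.
Proof.
apply: measurable_fun_ifT => //; last exact: measurableT_comp.
by apply: measurable_and; exact: measurable_fun_lte.
Qed.

Let integral_abs_u_lty :
  \int[sigma]_(x in [set: borel T]) (`|u x| `^ q) < +oo.
Proof.
rewrite -poweR_Lnorm ?gt_eqF// poweR_lty//.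
exact: uLq.2.
Qed.

Let uw : {ae sigma, forall x : borel T, u x = (w x)%:E}.
Proof.
have mabs : measurable_fun [set: borel T] (fun x => `|u x| `^ q).
  by apply: measurable_fun_poweR; exact: measurableT_comp.
have : sigma.-integrable [set: borel T] (fun x => `|u x| `^ q).
  apply/integrableP; split=> //.
  by under eq_integral do rewrite gee0_abs ?poweR_ge0//.
move=> /(integrable_ae measurableT) ufin.
apply: filterS2 ufin uG.2 => x /(_ I) ux u0.
have uoo : u x < +oo.
  move: ux u0; case: (u x) => [r| |]//; rewrite ?ltry//.
  by rewrite /= gt_eqF.
by rewrite /w u0 uoo/= fineK// gt0_fin_numE.
Qed.

Let mwq : measurable_fun [set: borel T] (fun x => (w x `^ q)%:E).
Proof.
apply/measurable_EFinP.
exact: (measurableT_comp (@measurable_powR R q) mw).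
Qed.

Let Iuw : Iu = \int[sigma]_(x in [set: borel T]) (w x `^ q)%:E.
Proof.
apply: ae_eq_integral => //; first exact: measurable_fun_poweR.
by apply: filterS uw => x -> _; rewrite poweR_EFin.
Qed.

Let Iu_lty : Iu < +oo.
Proof.
apply: le_lt_trans integral_abs_u_lty.
apply: ae_ge0_le_integral => //.
- by move=> x _; exact: poweR_ge0.
- exact: measurable_fun_poweR.
- by move=> x _; exact: poweR_ge0.
- by apply: measurable_fun_poweR; exact: measurableT_comp.
- by apply: filterS uG.2 => x ux _; rewrite gee0_abs// ltW.
Qed.

Let mG := lower_semicontinuous_prod_measurable scT lscG.

Let Gw : {ae sigma, forall x : borel T,
  \int[sigma]_(y in [set: borel T]) (G (x, y) * (w y `^ q)%:E) <= (w x)%:E}.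
Proof.
apply: filterS2 uw uG.1 => x <-; apply: le_trans.
have mGx : measurable_fun [set: borel T] (fun y : borel T => G (x, y)).
  exact: (measurableT_comp mG (pair1_measurable x)).
rewrite le_eqVlt; apply/orP; left; apply/eqP; apply: ae_eq_integral => //.
- exact: emeasurable_funM.
- by apply: emeasurable_funM => //; exact: measurable_fun_poweR.
- by apply: filterS uw => y -> _; rewrite poweR_EFin.
Qed.

Lemma quasi_symmetric_estimate_small : (q ^+ 2 + q <= 1)%R ->
  let bound := (a `^ (q ^+ 2 / (1 - q)))%:E * Iu in
  \int[sigma]_(x in [set: borel T]) (potential G sigma x `^ (q / (1 - q))) <=
  bound /\ bound < +oo.
Proof.
move=> qq bound; split; last by rewrite lte_mul_pinfty// lee_fin powR_ge0.
have [m sE] := sigma_finite_measureP (locally_finite_sigma_finite scT lfs).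
have Gm := Gw; rewrite /bound Iuw; rewrite sE in Gm *.
apply: (potential_estimate_small mG _ a0 _ q0 q1 mw w0 Gm qq) => //.
by move=> x y; exact: (qsG x y).2.
Qed.

Lemma quasi_symmetric_estimate_large (s : R) : (1 < q ^+ 2 + q)%R ->
  sigma [set: borel T] < +oo -> (0 < s <= 1 + q)%R ->
  let bound := (a `^ (s / (1 + q)))%:E * (Iu `^ (s * (1 - q) / q) *
    sigma [set: borel T] `^ (1 - s * (1 - q) / q)) in
  \int[sigma]_(x in [set: borel T]) (potential G sigma x `^ s) <= bound /\
  bound < +oo.
Proof.
move=> qq soo s01 bound; split; last first.
  rewrite lte_mul_pinfty ?lee_fin ?powR_ge0//.
  rewrite lte_mul_pinfty ?poweR_ge0 ?poweR_lty//.
  by rewrite fin_num_poweR// ge0_fin_numE// integral_ge0// => x _; exact: poweR_ge0.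
have [m sE] := sigma_finite_measureP (locally_finite_sigma_finite scT lfs).
have Gm := Gw; rewrite /bound Iuw; rewrite sE in Gm soo *.
apply: (potential_estimate_large mG _ a0 _ q0 q1 mw w0 Gm soo qq s01) => //.
by move=> x y; exact: (qsG x y).2.
Qed.

End Estimates.

Theorem lemma5p1 (R : realType) (T : ptopologicalType)
    (lcT : locally_compact [set: T]) (hT : hausdorff_space T)
    (scT : @second_countable T)
    (q : R) (q0 : (0 < q)%R) (q1 : (q < 1)%R)
    (G : T * T -> \bar R) (G0 : forall z, 0 <= G z)
    (lscG : lower_semicontinuous G)
    (a : R) (a0 : (0 < a)%R) (qsG : quasi_symmetric G a)
    (sigma : {measure set (borel T) -> \bar R})
    (lfs : locally_finite sigma)
    (u : T -> \bar R) (uLq : in_Lspace sigma q u)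
    (uG : positive_supersolution G sigma q u) :
  let qstar : R := ((Num.sqrt 5 - 1) / 2)%R in
  let Ipot (s : R) := \int[sigma]_(x in [set: borel T])
                        (potential G sigma x `^ s) in
  let Iu := \int[sigma]_(x in [set: borel T]) (u x `^ q) in
  let estimate_a (c : R) :=
    (q <= qstar)%R ->
      Ipot (q / (1 - q))%R <= c%:E * Iu /\ c%:E * Iu < +oo in
  let estimate_b (c : R -> R) :=
    (qstar < q)%R -> sigma [set: borel T] < +oo ->
    forall s : R, (0 < s)%R -> (s <= 1 + q)%R ->
      let bound := (c s)%:E * (Iu `^ (s * (1 - q) / q)%R *
        sigma [set: borel T] `^ (1 - s * (1 - q) / q)%R) in
      Ipot s <= bound /\ bound < +oo in
  [/\ estimate_a (a `^ (q ^+ 2 / (1 - q)))%R,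
      estimate_b (fun s => a `^ (s / (1 + q)))%R
    & symmetric_kernel G -> estimate_a 1%R /\ estimate_b (fun=> 1%R)].
Proof.
move=> qstar Ipot Iu estimate_a estimate_b.
have est c : (0 < c)%R -> quasi_symmetric G c ->
    estimate_a (c `^ (q ^+ 2 / (1 - q)))%R /\
    estimate_b (fun s => c `^ (s / (1 + q)))%R.
  move=> c0 qsc; split=> [|qq soo s s0 s1].
    rewrite /estimate_a /qstar le_golden_ratio_conj// => qq.
    exact: quasi_symmetric_estimate_small.
  move: qq; rewrite ltNge /qstar le_golden_ratio_conj// -ltNge => qq.
  by apply: quasi_symmetric_estimate_large => //; rewrite s0.
split; [exact: (est a a0 qsG).1|exact: (est a a0 qsG).2|move=> symG].
have qs1 : quasi_symmetric G 1%R by move=> x y; rewrite invr1 !mul1e (symG x y).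
have [esta estb] := est 1%R ltr01 qs1.
split; first by move: esta; rewrite powR1.
by move=> qq soo s s0 s1; have := estb qq soo s s0 s1; rewrite powR1.
Qed.
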